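(* Let $X$ be a set, let $Y$ be a nonempty subset of $X$, and let $\mathbb{S}(Y)$ be a subsemigroup of $T(Y)$ such that $I_Y\in\mathbb{S}(Y)$. Then $T_{\mathbb{S}(Y)}(X)$ is a unit-regular semigroup if and only if one of the following holds: (i) $\mathbb{S}(Y)$ is a subgroup of $\mathrm{Sym}(Y)$ and $X\setminus Y$ is finite; (ii) $\mathbb{S}(Y)$ is unit-regular and $Y=X$.
   Context: For a set $A$, $T(A)$ is the semigroup of all maps $A\to A$ under composition (composed from left to right, with $xf$ denoting the image of $x$ under $f$), $I_A$ is the identity map on $A$, and $\mathrm{Sym}(A)$ is the group of all bijections $A\to A$. For $f\in T(X)$ with $Yf\subseteq Y$, $f_{\upharpoonright_Y}\in T(Y)$ denotes the map $Y\to Y$ that agrees with $f$ on $Y$. Define $T_{\mathbb{S}(Y)}(X)=\{f\in T(X) : Yf\subseteq Y \text{ and } f_{\upharpoonright_Y}\in\mathbb{S}(Y)\}$, a subsemigroup of $T(X)$; it contains $I_X$ when $I_Y\in\mathbb{S}(Y)$. In a semigroup $S$ with identity, $U(S)$ is the set of units of $S$, and $a\in S$ is unit-regular if there is $u\in U(S)$ with $aua=a$; $S$ is unit-regular if all its elements are unit-regular. *)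

(* Defs.v *)
From HB Require Import structures.
From mathcomp Require Import all_boot.
From mathcomp Require Import boolp classical_sets functions cardinality.

Set Implicit Arguments.
Unset Strict Implicit.
Unset Printing Implicit Defensive.

Local Open Scope classical_set_scope.
Local Open Scope group_scope.

(* Subsemigroups are sets of elements of an ambient semigroup [M].  Identities
   and units are relative to the subset [S]: nothing is assumed about an
   identity of [M]. *)
Section SubSemigroup.
Variable M : semigroupType.
Implicit Types S : set M.

Definition subsemigroup S : Prop :=
  S !=set0 /\ forall a b, S a -> S b -> S (a * b).

Definition is_identity S (e : M) : Prop :=
  S e /\ forall a, S a -> e * a = a /\ a * e = a.

Definition units S : set M :=
  [set u | S u /\ exists e, is_identity S e /\
     exists v, [/\ S v, u * v = e & v * u = e]].

Definition unit_regular_elt S (a : M) : Prop :=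
  exists u, units S u /\ a * u * a = a.

Definition unit_regular S : Prop :=
  (exists e, is_identity S e) /\ forall a, S a -> unit_regular_elt S a.

End SubSemigroup.

(* The full transformation monoid T(A).  Maps act on the right, so the product
   [f * g] applies [f] first. *)
Definition transf (A : Type) : Type := A -> A.

HB.instance Definition _ (A : Type) := gen_eqMixin (transf A).
HB.instance Definition _ (A : Type) := gen_choiceMixin (transf A).

Section Transf.
Variable A : Type.

Definition transf_mul (f g : transf A) : transf A := g \o f.
Definition transf_one : transf A := id.

Fact transf_mulA : associative transf_mul. Proof. by []. Qed.
Fact transf_1mul : left_id transf_one transf_mul. Proof. by []. Qed.
Fact transf_mul1 : right_id transf_one transf_mul. Proof. by []. Qed.

HB.instance Definition _ :=
  isMonoid.Build (transf A) transf_mulA transf_1mul transf_mul1.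

Definition Sym : set (transf A) := [set f : transf A | bijective f].

Definition subgroup_of_Sym (G : set (transf A)) : Prop :=
  [/\ G `<=` Sym, G 1, forall f g, G f -> G g -> G (f * g)
    & forall f, G f -> exists g, [/\ G g, f * g = 1 & g * f = 1]].

End Transf.

Section TransfRestr.
Variables (X : Type) (Y : set X).

Definition restr (f : transf X) (fY : set_fun Y Y f) : transf Y :=
  fun y => SigSub (mem_set (fY (val y) (set_valP y))).

Definition transf_restr (S : set (transf Y)) : set (transf X) :=
  [set f | exists fY : set_fun Y Y f, S (restr fY)].

Lemma transf_restr1 (S : set (transf Y)) : S 1 -> transf_restr S 1.
Proof.
move=> S1; exists (fun _ Yx => Yx); rewrite (_ : restr _ = 1) //.
by apply/funext => y; apply: val_inj.
Qed.

Lemma transf_restr_subsemigroup (S : set (transf Y)) :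
  subsemigroup S -> S 1 -> subsemigroup (transf_restr S).
Proof.
move=> [_ SM] S1; split; first by exists 1; exact: transf_restr1.
move=> f g [fY Sf] [gY Sg]; exists (fun x Yx => gY _ (fY x Yx)).
rewrite (_ : restr _ = restr fY * restr gY); last first.
  by apply/funext => y; apply: val_inj.
exact: SM.
Qed.

End TransfRestr.

(* Main.v *)
(** A unit [u] of a monoid [S] with [a u a = a] makes [a] invertible as soon as
    [a] is injective or surjective.  Extending [s] in [S(Y)] by mapping
    [X \ Y] to a single point of [Y] outside the image of [s] gives a map that is not
    unit-regular, so when [Y <> X] every [s] is surjective, hence a unit.
    Extending the identity of [Y] by a Hilbert-hotel shift of an infinite
    [X \ Y] gives an injective non-surjective map, so [X \ Y] is finite.
    Conversely, when [f] is bijective on [Y] and [X \ Y] is finite, each point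
    of the image of [f] outside [Y] has all its preimages outside [Y], and a
    permutation of [X \ Y] choosing such preimages, glued to the inverse of
    [f] on [Y], is the required unit. *)
Require Import Defs.
From mathcomp Require Import all_boot.
From mathcomp Require Import boolp classical_sets functions cardinality.

Set Implicit Arguments.
Unset Strict Implicit.
Unset Printing Implicit Defensive.

Local Open Scope classical_set_scope.
Local Open Scope group_scope.

Section SubmonoidUnits.
Context {M : monoidType} (S : set M) (S1 : S 1).

Lemma is_identity1 : is_identity S 1.
Proof. by split=> // a _; rewrite mul1g mulg1. Qed.

(** Since [1] lies in [S], any identity [e] of [S] satisfies [e = e * 1 = 1]. *)
Lemma unitsP (u : M) :
  units S u <-> S u /\ exists v, [/\ S v, u * v = 1 & v * u = 1].
Proof.
split=> [[Su [e [[Se eP] vP]]]|[Su vP]]; split=> //.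
  by have [+ _] := eP 1 S1; rewrite mulg1 => <-.
by exists 1; split=> //; exact: is_identity1.
Qed.

End SubmonoidUnits.

Section SectionPermutation.
Context {T : eqType}.

Definition swap (a b x : T) : T :=
  if x == a then b else if x == b then a else x.

Lemma swapK (a b : T) : involutive (swap a b).
Proof.
move=> x; rewrite /swap; have [->|xa] := eqVneq x a.
  by have [//|_] := eqVneq b a; rewrite eqxx.
have [->|xb] := eqVneq x b; first by rewrite eqxx.
by rewrite (negPf xa) (negPf xb).
Qed.

(* The section is built one point at a time: to send [y] to a preimage [x] of
   [y], compose with the transposition of [p y] and [x]; no point [b <> y]
   already treated is moved, since [p b] is a preimage of [b]. *)
Lemma section_permutation (f : T -> T) (Z : set T) (s : seq T) :
  (forall y, y \in s -> Z y) ->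
  (forall y, y \in s -> exists2 x, Z x & f x = y) ->
  exists p : T -> T, [/\ bijective p, forall x, ~ Z x -> p x = x
    & forall y, y \in s -> f (p y) = y].
Proof.
elim: s => [|y s IHs] sZ sf; first by exists id; split=> //; exists id.
have [b bs|b bs|p [p_bij pE fp]] := IHs.
- by apply: sZ; rewrite inE bs orbT.
- by apply: sf; rewrite inE bs orbT.
have Zy : Z y by apply: sZ; rewrite mem_head.
have [x Zx fx] : exists2 x, Z x & f x = y by apply: sf; rewrite mem_head.
have p_inj := bij_inj p_bij.
exists (swap (p y) x \o p); split.
- exact: (bij_comp (inv_bij (swapK _ _)) p_bij).
- move=> z NZz; rewrite /= /swap (inj_eq p_inj) pE //.
  have [zy|_] := eqVneq z y; first by rewrite zy in NZz.
  by have [zx|//] := eqVneq z x; rewrite zx in NZz.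
- move=> b; rewrite inE /= /swap (inj_eq p_inj); have [-> //|by_] := eqVneq b y.
  move=> /= bs; have [pbx|_] := eqVneq (p b) x; last exact: fp.
  by move: by_; rewrite -(fp b bs) pbx fx eqxx.
Qed.

End SectionPermutation.

(** Embed the naturals into [A] by [g], send each [g n] to [g n.+1] and fix all other points; then
    [g 0] is missed. *)
Lemma infinite_shift (T : Type) (A : set T) : infinite_set A ->
  exists f : T -> T, [/\ injective f, forall x, ~ A x -> f x = x
    & exists x, forall z, f z <> x].
Proof.
move=> /infiniteP/card_leP[h].
pose g n : T := val (h (SigSub (mem_set (I : [set: nat] n)))).
have g_inj : injective g.
  move=> m n /val_inj /(@inj _ _ _ h) => H.
  by have /(congr1 val) := H (in_setT _) (in_setT _).
pose f x := if pselect (exists n, g n = x) is left e then g (sval (cid e)).+1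
            else x.
have fg n : f (g n) = g n.+1.
  rewrite /f; case: pselect => [e|]; last by case; exists n.
  by case: (cid e) => m /= /g_inj ->.
have fN x : ~ (exists n, g n = x) -> f x = x.
  by rewrite /f; case: pselect.
exists f; split.
- move=> x y; have [[m <-]|Nx] := pselect (exists n, g n = x);
    have [[n <-]|Ny] := pselect (exists n, g n = y).
  + by rewrite !fg => /g_inj[->].
  + by rewrite fg (fN _ Ny) => gy; case: Ny; exists m.+1.
  + by rewrite fg (fN _ Nx) => gx; case: Nx; exists n.+1.
  + by rewrite !fN.
- by move=> x Ax; apply: fN => -[n gx]; apply: Ax; rewrite -gx; exact: set_valP.
- exists (g 0%N) => z; have [[m <-]|Nz] := pselect (exists n, g n = z).
    by rewrite fg => /g_inj.
  by rewrite fN // => gz; apply: Nz; exists 0%N.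
Qed.

Section Extension.
Context {X : Type} {Y : set X}.
Implicit Types (S : set (transf Y)) (s t : transf Y) (g : transf X).

Definition extend s g : transf X :=
  fun x => if pselect (Y x) is left Yx then val (s (SigSub (mem_set Yx)))
           else g x.

Lemma extend_val s g (y : Y) : extend s g (val y) = val (s y).
Proof.
rewrite /extend; case: pselect => [Yy|[]]; last exact: set_valP.
by congr (val (s _)); apply: val_inj.
Qed.

Lemma extend_out s g x : ~ Y x -> extend s g x = g x.
Proof. by rewrite /extend; case: pselect. Qed.

Lemma in_or_out x : (exists y : Y, x = val y) \/ ~ Y x.
Proof.
have [Yx|] := pselect (Y x); last by right.
by left; exists (SigSub (mem_set Yx)).
Qed.

(** Trades the dependent [restr] for pointwise equations, so that no proof of [set_fun Y Y g] has to
    be carried along. *)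
Lemma transf_restrP S g :
  transf_restr S g <-> exists2 s, S s & forall y : Y, g (val y) = val (s y).
Proof.
split=> [[gY Ss]|[s Ss gs]]; first by exists (restr gY).
have gY : set_fun Y Y g.
  move=> x Yx; have /= -> := gs (SigSub (mem_set Yx)); exact: set_valP.
exists gY; rewrite (_ : restr gY = s) //.
by apply/funext => y; apply: val_inj; rewrite /= gs.
Qed.

Lemma transf_restr_extend S s g : S s -> transf_restr S (extend s g).
Proof. by move=> Ss; apply/transf_restrP; exists s => // y; rewrite extend_val. Qed.

Lemma extend_mul1 s t g h : s * t = 1 -> (forall x, ~ Y x -> ~ Y (g x)) ->
  (forall x, ~ Y x -> h (g x) = x) -> extend s g * extend t h = 1.
Proof.
move=> st gY hg; apply/funext => x; change (extend t h (extend s g x) = x).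
have [[y ->]|Yx] := in_or_out x.
  by rewrite !extend_val; congr val; exact: (congr1 (fun k => k y) st).
by rewrite extend_out // extend_out ?hg //; exact: gY.
Qed.

Lemma extend_unit S s t g h : S 1 -> S s -> S t -> s * t = 1 -> t * s = 1 ->
  cancel g h -> cancel h g -> (forall x, ~ Y x -> ~ Y (g x)) ->
  (forall x, ~ Y x -> ~ Y (h x)) -> units (transf_restr S) (extend s g).
Proof.
move=> S1 Ss St st ts gh hg gY hY; apply/unitsP; first exact: transf_restr1.
split; first exact: transf_restr_extend.
exists (extend t h); split; first exact: transf_restr_extend.
- by apply: extend_mul1 => // x _; exact: gh.
- by apply: extend_mul1 => // x _; exact: hg.
Qed.

(** Restriction to [Y] is multiplicative, so it carries an inverse pair to an inverse pair. *)
Lemma units_transf_restr S u : S 1 -> units (transf_restr S) u ->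
  exists2 t, units S t & forall y : Y, u (val y) = val (t y).
Proof.
move=> S1 /unitsP[|/transf_restrP[t St ut] [v [/transf_restrP[w Sw vw] uv vu]]].
  exact: transf_restr1.
exists t => //; apply/unitsP => //; split=> //; exists w; split=> //.
- apply/funext => y; apply: val_inj.
  change (val (w (t y)) = val y); rewrite -vw -ut.
  exact: (congr1 (fun k => k (val y)) uv).
- apply/funext => y; apply: val_inj.
  change (val (t (w y)) = val y); rewrite -ut -vw.
  exact: (congr1 (fun k => k (val y)) vu).
Qed.

Lemma unit_regular_restr S :
  S 1 -> unit_regular (transf_restr S) -> unit_regular S.
Proof.
move=> S1 [_ reg]; split; first by exists 1; exact: is_identity1.
move=> s Ss.
have [u [/(units_transf_restr S1) [t tU ut] fuf]] :=
  reg _ (transf_restr_extend id Ss).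
exists t; split=> //; apply/funext => y; apply: val_inj.
change (val (s (t (s y))) = val (s y)).
have := congr1 (fun k => k (val y)) fuf.
change (extend s id (u (extend s id (val y))) = extend s id (val y) ->
  val (s (t (s y))) = val (s y)).
by rewrite !extend_val ut extend_val.
Qed.

Lemma transf_restr_unit_regular S :
  S 1 -> Y = setT -> unit_regular S -> unit_regular (transf_restr S).
Proof.
move=> S1 YT [_ reg]; split.
  by exists 1; apply: is_identity1; exact: transf_restr1.
move=> f /transf_restrP[s Ss fs].
have [t [/(unitsP S1)[St [w [Sw tw wt]]] sts]] := reg s Ss.
(* As [Y] is everything, [id] is only a filler here. *)
exists (extend t id); split; first exact: (extend_unit S1 St Sw tw wt).
apply/funext => x; change (f (extend t id (f x)) = f x).
have [[y ->]|] := in_or_out x; last by rewrite YT => /(_ I).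
by rewrite fs extend_val fs; congr val; exact: (congr1 (fun k => k y) sts).
Qed.

Lemma subgroup_of_Sym_regular S : S 1 -> subgroup_of_Sym S ->
  finite_set (~` Y) -> unit_regular (transf_restr S).
Proof.
move=> S1 [_ _ _ SV] Yfin; split.
  by exists 1; apply: is_identity1; exact: transf_restr1.
move=> f /transf_restrP[s Ss fs]; have [t [St st ts]] := SV s Ss.
have stE y : t (s y) = y := congr1 (fun k => k y) st.
have tsE y : s (t y) = y := congr1 (fun k => k y) ts.
(* The list [r] enumerates the image points outside [Y], for which [p] must choose preimages. *)
have : finite_set (~` Y `&` range f) by apply: finite_setIl.
move=> /(@finite_seqP {classic X})[r rE].
have rP z : z \in r <-> ~ Y z /\ exists x, f x = z.
  have -> : (z \in r : Prop) = (~` Y `&` range f) z by rewrite rE.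
  split=> [[Yz [x _ fx]]|[Yz [x fx]]]; first by split=> //; exists x.
  by split=> //; exists x.
have [z /rP[]//|z /rP[Yz [x fx]]|p [[q pq qp] pY fp]] :=
  @section_permutation {classic X} f (~` Y) r.
  (* A preimage of a point outside [Y] is outside [Y], because [f] maps [Y] into itself. *)
  exists x => // Yx; apply: Yz; rewrite -fx.
  by have /= -> := fs (SigSub (mem_set Yx)); exact: set_valP.
(* Fixing [Y] pointwise, the mutually inverse [p] and [q] both preserve its complement, as
   [extend_unit] requires. *)
have pE y : p (val (y : Y)) = val y by apply: pY; apply; exact: set_valP.
have qE y : q (val (y : Y)) = val y by rewrite -[in LHS](pE y) pq.
exists (extend t p); split.
  apply: (extend_unit S1 St Ss ts st pq qp) => x NYx.
    by have [[y py]|//] := in_or_out (p x); case: NYx;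
      rewrite -(pq x) py qE; exact: set_valP.
  by have [[y qy]|//] := in_or_out (q x); case: NYx;
    rewrite -(qp x) qy pE; exact: set_valP.
apply/funext => x; change (f (extend t p (f x)) = f x).
have [[y ->]|Yfx] := in_or_out (f x); first by rewrite extend_val fs tsE.
by rewrite extend_out //; apply: fp; apply/rP; split=> //; exists x.
Qed.

Lemma unit_regular_subgroup_of_Sym S : subsemigroup S -> S 1 ->
  Y <> setT -> unit_regular (transf_restr S) -> subgroup_of_Sym S.
Proof.
move=> [_ SM] S1 YT regX; have [_ reg] := unit_regular_restr S1 regX.
have [z NYz] : exists z, ~ Y z.
  by apply/existsNP => Yall; apply: YT; apply/seteqP; split.
have s_surj s : S s -> forall y, exists x, s x = y.
  (* Here [f] sends [z] to [val y], so [f * u * f = f] at [z] says that [f] fixes [val y] after [u];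
     as [u] acts on [Y] as [t], the point [t y] is a preimage of [y] under [s]. *)
  move=> Ss y; pose f := extend s (fun=> val y).
  have [u [/(units_transf_restr S1)[t _ ut] fuf]] :=
    regX.2 f (transf_restr_extend (fun=> val y) Ss).
  exists (t y); apply: val_inj; rewrite -(extend_val s (fun=> val y)) -ut.
  have := congr1 (fun k => k z) fuf.
  change (f (u (f z)) = f z -> f (u (val y)) = val y).
  by rewrite {2 3}/f extend_out.
have SV s : S s -> exists t, [/\ S t, s * t = 1 & t * s = 1].
  move=> Ss; have [t [/(unitsP S1)[St [w [Sw tw wt]]] sts]] := reg s Ss.
  (* Surjectivity cancels the first [s] in [s * t * s = s]; then [s] must be the inverse [w] of
     [t]. *)
  have ts : t * s = 1.
    apply/funext => y; have [x <-] := s_surj s Ss y.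
    exact: (congr1 (fun k => k x) sts).
  have sw : s = w by rewrite -[s]mul1g -wt -mulgA ts mulg1.
  by exists t; split=> //; rewrite sw.
split=> // s Ss; have [t [_ st ts]] := SV s Ss.
exists t => y; first exact: (congr1 (fun k => k y) st).
exact: (congr1 (fun k => k y) ts).
Qed.

Lemma unit_regular_finite_setC S : S 1 ->
  unit_regular (transf_restr S) -> finite_set (~` Y).
Proof.
move=> S1 [_ reg]; apply: contrapT => /infinite_shift[f [f_inj fY [x fx]]].
have Tf : transf_restr S f.
  by apply/transf_restrP; exists 1 => // y; apply: fY; apply; exact: set_valP.
have [u [uU fuf]] := reg f Tf.
have [_ [v [_ uv _]]] := (unitsP (transf_restr1 S1) u).1 uU.
(* Injectivity cancels the last [f] in [f * u * f = f]. Then [u (f (u x)) = u x], and applying [v]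
   shows that [f] hits the missed point [x]. *)
have fu z : u (f z) = z by apply: f_inj; exact: (congr1 (fun k => k z) fuf).
have vuE z : v (u z) = z := congr1 (fun k => k z) uv.
by apply: (fx (u x)); rewrite -[LHS]vuE fu.
Qed.

End Extension.

Theorem theorem3p8 (X : Type) (Y : set X) (S : set (transf Y))
    (Y_neq0 : Y !=set0) (S_sub : subsemigroup S) (S1 : S 1) :
  unit_regular (transf_restr S) <->
    (subgroup_of_Sym S /\ finite_set (~` Y)) \/
    (unit_regular S /\ Y = setT).
Proof.
split=> [reg|[[Sgrp Yfin]|[regS YT]]].
- have [YT|YT] := pselect (Y = setT).
    by right; split=> //; exact: unit_regular_restr reg.
  left; split; first exact: unit_regular_subgroup_of_Sym reg.
  exact: unit_regular_finite_setC reg.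
- exact: subgroup_of_Sym_regular.
- exact: transf_restr_unit_regular.
Qed.
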